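(* In the sum network creation game with $n$ players and link price $\alpha > 17n$, the graph $G_s$ of every Nash equilibrium $s$ is a tree.
   Context: Sum network creation game: players $V=\{1,\dots,n\}$ and a parameter $\alpha>0$. A strategy of player $u$ is a set $s_u\subseteq V\setminus\{u\}$, and a strategy vector is $s=(s_u)_{u\in V}$. The graph $G_s$ has vertex set $V$ and an edge $uv$ whenever $v\in s_u$ or $u\in s_v$. The cost of player $u$ is $c_u(s)=\alpha|s_u|+\sum_{v\neq u} d_{G_s}(u,v)$, where $d_{G_s}$ is the graph distance (infinite if $G_s$ is disconnected). A Nash equilibrium is a strategy vector $s$ such that for every player $u$ and every strategy vector $s'$ differing from $s$ only in the strategy of $u$, $c_u(s)\le c_u(s')$. *)

(* Defs.v *)
From mathcomp Require Import all_boot all_order all_algebra.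
Set Implicit Arguments. Unset Strict Implicit. Unset Printing Implicit Defensive.
Import Order.TTheory GRing.Theory Num.Theory.

(* A strategy vector for n players: player u buys the set s u of links. *)
Definition strategy (n : nat) := {ffun 'I_n -> {set 'I_n}}.

Definition valid_strategy n (s : strategy n) : Prop := forall u, u \notin s u.

Definition adj n (s : strategy n) : rel 'I_n :=
  fun u v => (v \in s u) || (u \in s v).

Fixpoint ball n (s : strategy n) (u : 'I_n) (k : nat) : {set 'I_n} :=
  match k with
  | 0 => [set u]
  | k'.+1 => ball s u k' :|: [set y | [exists x in ball s u k', adj s x y]]
  end.

(* graph distance: Some d, or None for infinite (different components).
   A shortest path has at most n-1 edges, so searching k <= n suffices. *)
Definition dist n (s : strategy n) (u v : 'I_n) : option nat :=
  if v \in ball s u n then Some (find (fun k => v \in ball s u k) (iota 0 n.+1))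
  else None.

(* cost of player u; None encodes +infinity *)
Definition cost (R : realFieldType) n (alpha : R) (s : strategy n) (u : 'I_n)
  : option R :=
  if [forall v, dist s u v != None] then
    Some (alpha * (#|s u|)%:R + (\sum_(v | v != u) odflt 0%N (dist s u v))%:R)%R
  else None.

Definition le_cost (R : realFieldType) (a b : option R) : Prop :=
  match a, b with
  | _, None => True
  | None, Some _ => False
  | Some x, Some y => (x <= y)%R
  end.

Definition deviate n (s : strategy n) (u : 'I_n) (t : {set 'I_n}) : strategy n :=
  [ffun v => if v == u then t else s v].

Definition nash_equilibrium (R : realFieldType) n (alpha : R) (s : strategy n) : Prop :=
  valid_strategy s /\
  forall (u : 'I_n) (t : {set 'I_n}), u \notin t ->
    le_cost (cost alpha s u) (cost alpha (deviate s u t) u).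

Definition is_tree n (s : strategy n) : Prop :=
  (forall u v : 'I_n, connect (adj s) u v) /\
  (forall p : seq 'I_n, ~ (ucycle (adj s) p /\ 3 <= size p)).

(* Main.v *)
Require Import Defs.
From mathcomp Require Import all_boot all_order all_algebra.
From mathcomp Require Import zify.
Import Order.TTheory GRing.Theory Num.Theory.

(* Let r be a player of least total distance and T a breadth-first tree from r;
   call the edges outside T crossings.  Deleting a crossing costs its buyer u at
   most n * d(r, u), so u is deep in T (depth at least 18).  A player other than
   r cannot own two edges that are each a crossing, a parent edge, or a child
   edge leading within two steps to a buyer of a crossing: replacing both by one
   edge to r saves alpha and costs at most 7n.  Hence the last edges of the tree
   path from r to a buyer u are all owned by their upper end, and the last four
   vertices of these paths are disjoint for distinct buyers.  On the other hand
   the subtree of T spanned by the ends of the m crossings has fewer than 2m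
   vertices, apart from r, at which it branches or an additional crossing ends.
   So for some buyer two consecutive ones z1, z2 among these four vertices have
   degree two in the resulting graph.  There z2 could replace its edge to z1 by
   an edge to the successor z0 of z1, and z1 could replace its edge to z0 by an
   edge to r; together with the minimality of r the two inequalities are
   incompatible. *)

(** * Balls and graph distance *)

Section Distance.
Set Implicit Arguments.
Unset Strict Implicit.
Variable n : nat.
Implicit Types (s : strategy n) (u v w x y z : 'I_n) (k l : nat).

Lemma adj_sym s : symmetric (adj s).
Proof. by move=> x y; rewrite /adj orbC. Qed.

Lemma mem_ballS s u k y :
  (y \in ball s u k.+1) =
  (y \in ball s u k) || [exists x in ball s u k, adj s x y].
Proof. by rewrite /= in_setU inE. Qed.

Lemma ballxx s u k : u \in ball s u k.
Proof. by elim: k => [|k IH]; rewrite ?mem_ballS ?IH // inE. Qed.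

Lemma ball_le {s u k} l v : k <= l -> v \in ball s u k -> v \in ball s u l.
Proof.
move=> le_kl vk; rewrite -(subnK le_kl).
by elim: (l - k) => [|m IH] //; rewrite addSn mem_ballS IH.
Qed.

Lemma ball_rcons {s u v k} y : v \in ball s u k -> adj s v y -> y \in ball s u k.+1.
Proof.
move=> uv vy; rewrite mem_ballS; apply/orP; right.
by apply/existsP; exists v; rewrite uv.
Qed.

Lemma ball_trans {s u k l} v y :
  v \in ball s u k -> y \in ball s v l -> y \in ball s u (k + l).
Proof.
move=> uv; elim: l y => [|l IH] y; first by rewrite inE addn0 => /eqP->.
rewrite mem_ballS addnS => /orP[/IH|/existsP[x /andP[/IH ux xy]]].
  exact: ball_le.
exact: ball_rcons ux xy.
Qed.

Lemma ball_adj s u v : adj s u v -> v \in ball s u 1.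
Proof. by move=> uv; apply: ball_rcons (ballxx s u 0) uv. Qed.

Lemma ball_cons {s u k} v y : adj s u v -> y \in ball s v k -> y \in ball s u k.+1.
Proof. by move=> /ball_adj uv vy; apply: ball_trans uv vy. Qed.

Lemma ball_sym {s u v k} : v \in ball s u k -> u \in ball s v k.
Proof.
elim: k v => [|k IH] v; first by rewrite !inE eq_sym.
rewrite mem_ballS => /orP[/IH|/existsP[x /andP[/IH xu xv]]]; first exact: ball_le.
by apply: ball_cons xu; rewrite adj_sym.
Qed.

Lemma ballP s u v k :
  reflect (exists p, [/\ path (adj s) u p, last u p = v & size p <= k])
          (v \in ball s u k).
Proof.
apply: (iffP idP) => [|[p]].
  elim: k v => [|k IH] v; first by rewrite inE => /eqP->; exists [::].
  rewrite mem_ballS => /orP[/IH[p [pp lp sp]]|]; first by exists p; split=> //; lia.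
  case/existsP=> x /andP[/IH[p [pp lp sp]] xv]; exists (rcons p v).
  by rewrite rcons_path last_rcons size_rcons pp lp.
elim: p u k => [|a p IH] u k /=; first by case=> _ -> _; exact: ballxx.
case=> /andP[ua pp] lp; case: k => // k sp.
by apply: ball_cons ua _; apply: IH.
Qed.

(** A path without repeated vertices has fewer than [n] edges, so radius [n] captures
    connectedness. *)
Lemma connect_ball s u v : (v \in ball s u n) = connect (adj s) u v.
Proof.
apply/idP/connectP => [/ballP[p [pp lp _]]|[p pp ->]]; first by exists p.
case/shortenP: pp => q qq uq _; apply/ballP; exists q; split=> //.
by have := max_card (mem (u :: q)); rewrite (card_uniqP uq) card_ord /=; apply: ltnW.
Qed.

Lemma ball_bound {s u v k} : v \in ball s u k -> v \in ball s u n.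
Proof.
case/ballP=> p [pp lp _]; rewrite connect_ball.
by apply/connectP; exists p.
Qed.

(** The finite part of [dist]; for an unreachable [v] its value is [n.+1]. *)
Definition gdist s u v := find (fun k => v \in ball s u k) (iota 0 n.+1).

Lemma dist_gdist s u v : v \in ball s u n -> dist s u v = Some (gdist s u v).
Proof. by rewrite /dist => ->. Qed.

Lemma dist_None s u v : (dist s u v != None) = (v \in ball s u n).
Proof. by rewrite /dist; case: ifP. Qed.

Lemma gdist_ball s u v : v \in ball s u n -> v \in ball s u (gdist s u v).
Proof.
move=> uv; have has_uv : has (fun k => v \in ball s u k) (iota 0 n.+1).
  by apply/hasP; exists n => //; rewrite mem_iota; lia.
have := nth_find 0 has_uv; rewrite nth_iota ?add0n //.
by rewrite -[X in _ < X](size_iota 0 n.+1) -has_find.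
Qed.

Lemma gdist_le {s u v k} : v \in ball s u k -> gdist s u v <= k.
Proof.
move=> uv; have [lt_nk|le_kn] := ltnP n k.
  have := find_size (fun k => v \in ball s u k) (iota 0 n.+1).
  by rewrite size_iota -/(gdist s u v); lia.
rewrite leqNgt; apply/negP => lt_k.
have := before_find 0 lt_k; by rewrite nth_iota ?add0n ?uv.
Qed.

Lemma gdistxx s u : gdist s u u = 0.
Proof. by apply/eqP; rewrite -leqn0; apply: gdist_le; rewrite ballxx. Qed.

Lemma adj_deviate s z t x y : x != z -> y != z -> adj (deviate s z t) x y = adj s x y.
Proof. by rewrite /adj !ffunE => /negbTE-> /negbTE->. Qed.

Lemma adj_deviate_at s z t y :
  y != z -> adj (deviate s z t) z y = (y \in t) || (z \in s y).
Proof. by rewrite /adj !ffunE eqxx => /negbTE->. Qed.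

End Distance.

(** * Deviations from an equilibrium *)

Section Equilibrium.
Set Implicit Arguments.
Unset Strict Implicit.
Variables (R : realFieldType) (n : nat) (alpha : R) (s : strategy n).
Hypothesis alpha_gt : (17 * n%:R < alpha)%R.
Hypothesis alpha_gt0 : (0 < alpha)%R.
Hypothesis nash : nash_equilibrium alpha s.

Lemma cost_connected (s' : strategy n) u :
  (forall x, x \in ball s' u n) ->
  cost alpha s' u =
    Some (alpha * (#|s' u|)%:R + (\sum_x gdist s' u x)%:R)%R.
Proof.
move=> conn; rewrite /cost; case: ifPn => [_|/forallPn[x]]; last by rewrite dist_None conn.
congr (Some (_ + _%:R)%R); rewrite [RHS](bigD1 u) //= gdistxx add0n.
by apply: eq_bigr => x _; rewrite dist_gdist.
Qed.

(** Buying links to all other players has finite cost, so the cost in equilibrium is finite too. *)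
Lemma nash_connected u v : v \in ball s u n.
Proof.
have [_ /(_ u (~: [set u]))] := nash; rewrite !inE eqxx => /(_ isT).
rewrite [cost _ (deviate _ _ _) _]cost_connected.
  rewrite /cost; case: ifP => // /forallP conn _.
  by rewrite -dist_None.
move=> x; apply: (@ball_bound _ _ _ _ 1); have [->|xu] := eqVneq x u; first exact: ballxx.
by apply: ball_adj; rewrite adj_deviate_at // !inE xu.
Qed.

(** Since [f] need only bound the new distances, applying this amounts to exhibiting paths. *)
Lemma nash_deviate u (t : {set 'I_n}) (f : 'I_n -> nat) : u \notin t ->
  (forall x, x \in ball (deviate s u t) u (f x)) ->
  (alpha * (#|s u|)%:R + (\sum_x gdist s u x)%:R <=
   alpha * (#|t|)%:R + (\sum_x f x)%:R)%R.
Proof.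
move=> ut bf; have [_ /(_ u t ut)] := nash.
rewrite !cost_connected /=.
- rewrite ffunE eqxx => /le_trans-> //; rewrite lerD2l ler_nat.
  by apply: leq_sum => x _; apply: gdist_le.
- by move=> x; apply: ball_bound (bf x).
exact: nash_connected.
Qed.

Lemma nash_replace u (t : {set 'I_n}) (f : 'I_n -> nat) : u \notin t -> #|t| <= #|s u| ->
  (forall x, x \in ball (deviate s u t) u (f x)) ->
  \sum_x gdist s u x <= \sum_x f x.
Proof.
move=> ut lt bf; have := nash_deviate ut bf; rewrite -(ler_nat R) => le_cost.
rewrite -(lerD2l (alpha * #|s u|%:R)); apply: le_trans le_cost _.
by rewrite lerD2r ler_pM2l // ler_nat.
Qed.

(** Each link saved is worth more than [17 * n], which the growth of the distances must outweigh. *)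
Lemma nash_delete u (t : {set 'I_n}) (f : 'I_n -> nat) : u \notin t -> #|t| < #|s u| ->
  (forall x, x \in ball (deviate s u t) u (f x)) ->
  17 * n + \sum_x gdist s u x < \sum_x f x.
Proof.
move=> ut lt bf; have := nash_deviate ut bf; rewrite -(ltr_nat R) => le_cost.
rewrite -(ltrD2l (alpha * #|t|%:R)); apply: lt_le_trans le_cost.
rewrite natrD natrM addrA ltrD2r (lt_le_trans (y := alpha * #|t|.+1%:R)%R) //.
  by rewrite -[#|t|.+1%:R%R]natr1 mulrDr mulr1 ltrD2l.
by rewrite ler_pM2l // ler_nat.
Qed.

End Equilibrium.

(** * Breadth-first tree and crossings *)

Section Structure.
Set Implicit Arguments.
Unset Strict Implicit.
Variables (n : nat) (s : strategy n).
Hypothesis valid : valid_strategy s.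
Hypothesis conn : forall u v, v \in ball s u n.
Implicit Types (u v w x y z c : 'I_n) (t : {set 'I_n}) (i j k : nat).

Local Notation d := (gdist s).
Local Notation D u := (\sum_x gdist s u x).

(** * Geodesics and their survival under deviations *)

Lemma in_ball u v k : (v \in ball s u k) = (d u v <= k).
Proof.
by apply/idP/idP => [/gdist_le//|le_k]; apply: ball_le le_k (gdist_ball (conn u v)).
Qed.

Lemma gdistC u v : d u v = d v u.
Proof.
by apply/eqP; rewrite eqn_leq -!in_ball; apply/andP; split; apply: ball_sym; rewrite in_ball.
Qed.

Lemma gdist_triangle v u w : d u w <= d u v + d v w.
Proof. by rewrite -in_ball; apply: (@ball_trans _ _ _ _ _ v); rewrite in_ball. Qed.

Lemma gdist_adj u v : adj s u v -> d u v <= 1.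
Proof. by move=> /ball_adj; rewrite in_ball. Qed.

Lemma gdist_eq0 u v : (d u v == 0) = (u == v).
Proof. by rewrite -leqn0 -in_ball inE eq_sym. Qed.

Lemma adj_neq u v : adj s u v -> u != v.
Proof.
by case: eqVneq => [->|//]; rewrite /adj orbb; have /negP := valid v.
Qed.

Lemma closer_neighbour u x : u != x -> exists2 y, adj s u y & d u x = (d y x).+1.
Proof.
rewrite -gdist_eq0 => ux.
have /ballP[[|y p] /= [pp lp sp]] := gdist_ball (conn u x).
  by move: ux; rewrite lp gdistxx.
case/andP: pp => uy pp; exists y => //.
have le_yx : d y x <= size p by rewrite -in_ball; apply/ballP; exists p.
have := gdist_triangle y u x; have := gdist_adj uy; lia.
Qed.

(* Vertices on a geodesic from y to x are closer to x than z is, so the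
   geodesic avoids z and survives any deviation of z. *)
Lemma deviate_closer z t y x :
  d y x < d z x -> x \in ball (deviate s z t) y (d y x).
Proof.
have [k] := ubnP (d y x); elim: k y => // k IH y le_k lt_z.
have [->|yx] := eqVneq y x; first exact: ballxx.
have [y' yy' dy'] := closer_neighbour yx; rewrite dy'.
apply: (ball_cons (v := y')); last by apply: IH; lia.
rewrite adj_deviate //; first by apply: contraTneq lt_z => ->; lia.
by apply: contraTneq lt_z => <-; lia.
Qed.

(** Since [c] is no closer to [x] than [z] is, no geodesic from [z] to [x] starts with the link to
    [c], the only one that [z] may give up. *)
Lemma deviate_unaffected z t c x :
  s z :\ c \subset t -> d z x <= d c x -> x \in ball (deviate s z t) z (d z x).
Proof.
move=> sub le_c; have [->|zx] := eqVneq z x; first exact: ballxx.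
have [y zy dy] := closer_neighbour zx; rewrite dy.
apply: (ball_cons (v := y)); last by apply: deviate_closer; lia.
rewrite adj_deviate_at; last by rewrite eq_sym adj_neq.
case/orP: zy => [zy|->]; last by rewrite orbT.
rewrite (subsetP sub) // !inE zy andbT; apply: contraTneq le_c => <-; lia.
Qed.

(** * The breadth-first tree rooted at [r] *)

Variable r : 'I_n.
Local Notation dep := (gdist s r).

(** The default value is taken only at [r], which thus becomes its own parent. *)
Definition par x := odflt x [pick y | adj s x y && (dep x == (dep y).+1)].

Lemma par_root : par r = r.
Proof. by rewrite /par; case: pickP => //= y /andP[_]; rewrite gdistxx. Qed.

Lemma parP x : x != r -> adj s x (par x) /\ dep x = (dep (par x)).+1.
Proof.
move=> xr; have [y xy] := closer_neighbour xr; rewrite gdistC (gdistC y) => dy.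
rewrite /par; case: pickP => [z /andP[xz /eqP]//|/(_ y)].
by rewrite xy dy eqxx.
Qed.

Lemma dep_par x : dep (par x) = (dep x).-1.
Proof.
have [->|/parP[_ ->]//] := eqVneq x r; by rewrite par_root gdistxx.
Qed.

Lemma dep_eq0 x : (dep x == 0) = (x == r).
Proof. by rewrite gdist_eq0 eq_sym. Qed.

Lemma dep_gt0 x : (0 < dep x) = (x != r).
Proof. by rewrite lt0n dep_eq0. Qed.

Lemma dep_adj x y : adj s x y -> dep y <= (dep x).+1.
Proof. by move=> /gdist_adj; have := gdist_triangle x r y; lia. Qed.

Lemma dep_iter i x : dep (iter i par x) = dep x - i.
Proof. by elim: i => [|i IH] /=; rewrite ?dep_par ?IH; lia. Qed.

Lemma iter_root i x : dep x <= i -> iter i par x = r.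
Proof. by move=> le_i; apply/eqP; rewrite -dep_eq0 dep_iter subn_eq0. Qed.

(* x lies in the subtree of y; as dep x - dep y is truncated, this is false when
   x is less deep than y. *)
Definition desc y x := iter (dep x - dep y) par x == y.

Lemma desc_iter i x : desc (iter i par x) x.
Proof.
rewrite /desc dep_iter; have [le_i|/ltnW lt_i] := leqP i (dep x); first by rewrite subKn.
by rewrite !iter_root //; lia.
Qed.

Lemma desc_dep y x : desc y x -> dep y <= dep x.
Proof. by move=> /eqP <-; rewrite dep_iter leq_subr. Qed.

Lemma descxx x : desc x x. Proof. exact: (desc_iter 0). Qed.

Lemma desc_trans y x z : desc z y -> desc y x -> desc z x.
Proof. by move=> /eqP zy /eqP yx; rewrite -zy -{2}yx -iterD desc_iter. Qed.

Lemma desc_par y x : desc y (par x) -> desc y x.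
Proof. by move=> yx; apply: desc_trans yx (desc_iter 1 x). Qed.

Lemma desc_up y x : desc y x -> y != x -> desc y (par x).
Proof.
move=> /eqP; case: (_ - _) => [/= -> /eqP//|i].
by rewrite iterSr => <- _; rewrite desc_iter.
Qed.

Lemma desc_root x : desc r x.
Proof. by rewrite -(iter_root (leqnn (dep x))) desc_iter. Qed.

(** Stated for any [s'] so as to cover deviations. At the root [par] stands still, so edges are
    required only below it. *)
Lemma tree_path (s' : strategy n) k x :
  (forall i, i < k -> iter i par x != r ->
     adj s' (iter i par x) (iter i.+1 par x)) ->
  iter k par x \in ball s' x k.
Proof.
elim: k => [|k IH] ok; first exact: ballxx.
have {}IH : iter k par x \in ball s' x k by apply: IH => i lt_i; apply: ok; lia.
have [e|nr] := eqVneq (iter k par x) r; last exact: ball_rcons IH (ok k _ nr).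
by apply: ball_le (leqnSn k) _; move: IH; rewrite /= e par_root.
Qed.

Lemma gdist_desc y x : desc y x -> d y x <= dep x - dep y.
Proof.
move=> /eqP yx; rewrite gdistC -in_ball -{1}yx; apply: tree_path => i _ /parP[]//.
Qed.

Lemma gdist_dep y x : dep x <= dep y + d y x.
Proof. exact: gdist_triangle. Qed.

(** The tree path from [x] up to [y] avoids [z]: either [z] is no ancestor of [x], or it lies above
    [y]. *)
Lemma deviate_climb z t y x :
  desc y x -> ~~ desc z x || (dep z < dep y) ->
  y \in ball (deviate s z t) x (dep x - dep y).
Proof.
move=> yx nz; rewrite -{1}(eqP yx); apply: tree_path => i lt_i nr.
have [a _] := parP nr.
suff nez k : k <= dep x - dep y -> iter k par x != z.
  by rewrite adj_deviate //= ?nez //; [lia|exact: (nez i.+1)].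
move=> le_k; apply: contraNneq (_ : ~~ false) => // e.
case/orP: nz => [|lt_z]; first by rewrite -e desc_iter.
by move: lt_z; rewrite -e dep_iter; have := desc_dep yx; lia.
Qed.

Lemma deviate_drop z t y x :
  desc y x -> ~~ desc z x || (dep z < dep y) ->
  x \in ball (deviate s z t) y (dep x - dep y).
Proof. by move=> yx nz; apply/ball_sym/deviate_climb. Qed.

(** * Crossings, directed from the buyer to the other end *)

Definition cross u w := [&& w \in s u, par w != u & par u != w].

Lemma cross_adj u w : cross u w -> adj s u w.
Proof. by rewrite /adj => /and3P[->]. Qed.

(** Every neighbour of [r] has [r] as its parent, so all edges at [r] are tree edges. *)
Lemma cross_nroot u w : cross u w -> u != r /\ w != r.
Proof.
move=> uw; have a := cross_adj uw; case/and3P: uw => _ wu uw.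
suff nr x y : adj s x y -> par y != x -> x != r.
  by split; [apply: nr a wu|apply: nr uw; rewrite adj_sym].
move=> xy /eqP yx; apply: contra_notN yx => /eqP e.
have := dep_adj xy; have yr : y != r by rewrite -e eq_sym adj_neq.
have [_ ->] := parP yr; rewrite e gdistxx => le1.
by apply/eqP; rewrite -dep_eq0; lia.
Qed.

Lemma tree_edge_deviate u w x : cross u w -> x != r ->
  adj (deviate s u (s u :\ w)) x (par x).
Proof.
move=> /and3P[uw wu nuw] /parP[a _]; have [xu|xu] := eqVneq x u.
  rewrite xu adj_deviate_at; last by rewrite -xu eq_sym adj_neq.
  by move: a; rewrite xu /adj !inE nuw.
have [pu|pu] := eqVneq (par x) u; last by rewrite adj_deviate.
rewrite pu adj_sym adj_deviate_at // !inE.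
have -> : x != w by apply: contraNneq wu => <-; rewrite pu.
by move: a; rewrite pu adj_sym.
Qed.

Lemma tree_up_deviate u w x k : cross u w ->
  iter k par x \in ball (deviate s u (s u :\ w)) x k.
Proof. by move=> uw; apply: tree_path => i _ nr; exact: tree_edge_deviate. Qed.

(** * Depth and position of crossings in an equilibrium *)

Hypothesis replace : forall u t (f : 'I_n -> nat), u \notin t -> #|t| <= #|s u| ->
  (forall x, x \in ball (deviate s u t) u (f x)) -> D u <= \sum_x f x.
Hypothesis delete : forall u t (f : 'I_n -> nat), u \notin t -> #|t| < #|s u| ->
  (forall x, x \in ball (deviate s u t) u (f x)) -> 17 * n + D u < \sum_x f x.
Hypothesis r_min : forall u, D r <= D u.

Lemma sum_const k : \sum_(x : 'I_n) k = n * k.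
Proof. by rewrite sum_nat_const card_ord. Qed.

(** Without its crossing, [u] still climbs to [r] and descends to [x]. The new distances sum to at
    most [n * dep u + D r], hence to at most [n * dep u + D u]. *)
Lemma cross_deep u w : cross u w -> 17 < dep u.
Proof.
move=> uw; have uwS : w \in s u by case/and3P: uw.
have := delete (u := u) (t := s u :\ w) (f := fun x => dep u + dep x).
rewrite !inE (negbTE (valid u)) andbF => /(_ isT).
rewrite [X in _ < X](cardsD1 w) uwS => /(_ (ltnSn _)) H.
have {}H : 17 * n + D u < \sum_x (dep u + dep x).
  have up x : r \in ball (deviate s u (s u :\ w)) x (dep x).
    by have := tree_up_deviate x (dep x) uw; rewrite iter_root.
  by apply: H => x; apply: (@ball_trans _ _ _ _ _ r); last apply: ball_sym.
have := r_min u; move: H; rewrite big_split /= sum_const; nia.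
Qed.

(* Otherwise the crossing closes a cycle of length at most 8, so that deleting it
   lengthens no distance by more than 6. *)
Lemma cross_exit u w j : cross u w -> j <= 3 -> ~~ desc (iter j par u) w.
Proof.
move=> uw le_j; apply/negP => yw.
have [ur wr] := cross_nroot uw; have deep := cross_deep uw.
have uwS : w \in s u by case/and3P: uw.
have := delete (u := u) (t := s u :\ w) (f := fun x => d u x + 6).
rewrite !inE (negbTE (valid u)) andbF => /(_ isT).
rewrite [X in _ < X](cardsD1 w) uwS => /(_ (ltnSn _)) H.
have {}H : 17 * n + D u < \sum_x (d u x + 6).
  apply: H => x; have [lt_w|ge_w] := ltnP (d w x) (d u x); last first.
    by apply: ball_le (leq_addr 6 _) _; apply: deviate_unaffected ge_w.
  apply: (@ball_le _ _ _ (7 + d w x)); first by lia.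
  apply: (@ball_trans _ _ _ _ _ w); last exact: deviate_closer.
  (* The detour through the ancestor has length at most [2 * j + 1], hence at most 7; one of these
     steps is gained back because [w] is closer to [x] than [u]. *)
  apply: (@ball_le _ _ _ (j + (dep w - dep (iter j par u)))).
    by rewrite dep_iter; have := dep_adj (cross_adj uw); lia.
  apply: (@ball_trans _ _ _ _ _ (iter j par u)); first exact: tree_up_deviate.
  apply: ball_sym; have := tree_up_deviate w (dep w - dep (iter j par u)) uw.
  by rewrite (eqP yw).
by move: H; rewrite big_split /= sum_const; lia.
Qed.


(** * Exchanging links for one link to the root *)

Definition near_cross c := exists u w j, [/\ cross u w, j <= 2 & iter j par u = c].

(** The condition is void for crossings and parent edges; only a child needs another way out of its
    subtree. *)
Definition deletable z e := e \in s z /\ (par e = z -> near_cross e).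

Definition hub z (A : {set 'I_n}) := r |: (s z :\: A).

Lemma hub_notin z A : z != r -> z \notin hub z A.
Proof. by move=> zr; rewrite !inE (negbTE zr) (negbTE (valid z)) andbF. Qed.

(** Only an inequality, since [r] may be among the links that are kept. *)
Lemma card_hub z (A : {set 'I_n}) : A \subset s z -> #|hub z A| + #|A| <= #|s z|.+1.
Proof.
move=> /setIidPr sub; have := cardsID A (s z); have := cardsU1 r (s z :\: A).
rewrite sub /hub => -> <-; case: (r \notin _);
  by move: #|A| #|_ :\: _| => a b; rewrite /=; lia.
Qed.

Lemma hub_outside z A x : z != r -> ~~ desc z x ->
  x \in ball (deviate s z (hub z A)) z (dep x).+1.
Proof.
move=> zr zx; apply: (ball_cons (v := r)).
  by rewrite adj_deviate_at 1?eq_sym // !inE eqxx.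
rewrite -[X in ball _ _ X]subn0 -[X in _ - X](gdistxx s r).
by apply: deviate_drop; rewrite ?desc_root ?zx.
Qed.

Lemma desc_child z x : desc z x -> z != x ->
  exists c, [/\ par c = z, c != r, desc c x & dep c = (dep z).+1].
Proof.
move=> zx nzx; have le_zx := desc_dep zx; move: (zx); rewrite /desc.
case e: (dep x - dep z) => [|k] /eqP => [/= xz|zk]; first by rewrite xz eqxx in nzx.
exists (iter k par x); have dc : dep (iter k par x) = (dep z).+1 by rewrite dep_iter; lia.
by split; [exact: zk|rewrite -dep_gt0 dc|exact: desc_iter|].
Qed.

Lemma hub_inside z (A : {set 'I_n}) x : desc z x ->
  (forall c, c \in A -> par c = z -> ~~ desc c x) ->
  x \in ball (deviate s z (hub z A)) z (dep x - dep z).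
Proof.
move=> zx nA; have [->|nzx] := eqVneq z x; first exact: ballxx.
have [c [cz cr cx dc]] := desc_child zx nzx; have le_cx := desc_dep cx.
have -> : dep x - dep z = (dep x - dep c).+1 by lia.
apply: (ball_cons (v := c)); last by apply: deviate_drop; rewrite // dc leqnn orbT.
have [a _] := parP cr; rewrite adj_sym cz in a.
rewrite adj_deviate_at; last by rewrite eq_sym adj_neq.
have cA : c \notin A by apply/negP => /nA/(_ cz); rewrite cx.
by rewrite !inE cA /= -orbA; apply/orP; right.
Qed.

(* A cut-off child c has a buyer u of a crossing (u, w) at most two levels below
   it, and w lies outside the subtree of z, so r reaches c through w and u. *)
Lemma hub_anywhere z (A : {set 'I_n}) x : z != r ->
  (forall c, c \in A -> par c = z -> near_cross c) ->
  x \in ball (deviate s z (hub z A)) z (dep x + 7).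
Proof.
move=> zr ex; have [zx|nzx] := boolP (desc z x); last first.
  by apply: ball_le (hub_outside A zr nzx); lia.
have [/existsP[c /and3P[cA /eqP cz cx]]|/existsPn none] :=
  boolP [exists c, [&& c \in A, par c == z & desc c x]]; last first.
  apply: ball_le (hub_inside zx _); first by lia.
  by move=> c cA cz; have := none c; rewrite cA cz eqxx.
have [u [w [j [uw le_j uc]]]] := ex c cA cz.
have deep := cross_deep uw; have dw := dep_adj (cross_adj uw).
have dc : dep c = dep u - j by rewrite -uc dep_iter.
have dz : dep z = dep u - j.+1 by rewrite -cz -uc -dep_iter.
(* The bound 2 in [near_cross] makes [j.+1 <= 3], as [cross_exit] demands. *)
have nzw : ~~ desc z w by rewrite -cz -uc; apply: (cross_exit (j := j.+1) uw).
have cu : desc c u by rewrite -uc desc_iter.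
have le_cx := desc_dep cx.
(* Since [dep u <= dep c + 2] and [dep w <= dep u + 1], the route through [r], [w], [u] and [c]
   exceeds [dep x] by at most 3 + 2 + 2 = 7. *)
apply: (@ball_le _ _ _ ((dep w).+2 + (dep u - dep c) + (dep x - dep c))); first by lia.
apply: (ball_trans (v := c)); last first.
  by apply: deviate_drop; rewrite ?cx //; apply/orP; right; lia.
apply: (ball_trans (v := u)); last first.
  by apply: deviate_climb; rewrite ?cu //; apply/orP; right; lia.
apply: ball_rcons (hub_outside A zr nzw) _; rewrite adj_sym adj_deviate ?cross_adj //.
  by apply/eqP => e; move: dz; rewrite -e; lia.
by apply: contraNneq nzw => ->; apply: descxx.
Qed.

(** Exchanging two such links for one to [r] would save a link, while the distances would sum to at
    most [D r + 7 * n], hence to at most [D z + 7 * n]. *)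
Lemma deletable_inj z e e' : z != r -> deletable z e -> deletable z e' -> e = e'.
Proof.
move=> zr [ez e_near] [e'z e'_near]; apply/eqP/negP => /negP nee'.
pose A := [set e; e'].
have sub : A \subset s z by rewrite subUset !sub1set ez.
have card_A : #|A| = 2 by rewrite cards2 nee'.
have := delete (hub_notin A zr) (f := fun x => dep x + 7).
have lt : #|hub z A| < #|s z| by have := card_hub sub; rewrite card_A; lia.
move=> /(_ lt) H; have {}H : 17 * n + D z < \sum_x (dep x + 7).
  by apply: H => x; apply: hub_anywhere => // c; rewrite !inE => /orP[] /eqP->.
by move: H (r_min z); rewrite big_split /= sum_const; lia.
Qed.

(** * Ownership of the tree paths above buyers *)

(** The successor of [iter i par u] on the walk down the tree to [u] and then over the crossing to
    [w]. *)
Definition out u w i := if i is i'.+1 then iter i' par u else w.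

(** Induction up the tree: owning the deletable link to [out u w i], the vertex [iter i par u]
    cannot own its parent edge as well. So the parent owns it, and it leads down towards the buyer
    [u]. *)
Lemma deletable_out u w i : cross u w -> i <= 3 -> deletable (iter i par u) (out u w i).
Proof.
move=> uw; have deep := cross_deep uw; elim: i => [|i IH] le_i.
  by case/and3P: (uw) => wS /eqP wu _; split=> //= /wu.
split; last by exists u, w, i.
have er : iter i par u != r by rewrite -dep_gt0 dep_iter; lia.
have [/orP[pS|//] de] := parP er.
have eq : par (iter i par u) = out u w i.
  apply: (deletable_inj er) (IH _); last exact: ltnW.
  by split=> // /(congr1 dep); rewrite -!iterS !dep_iter; lia.
case: i {IH er pS de} le_i eq => [|i] le_i /= eq; last first.
  by move: (congr1 dep eq); rewrite -!iterS !dep_iter; lia.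
by case/and3P: uw => _ _; rewrite eq eqxx.
Qed.

Lemma cross_inj u w w' : cross u w -> cross u w' -> w = w'.
Proof.
move=> uw uw'; have [ur _] := cross_nroot uw.
exact: deletable_inj ur (deletable_out uw (i := 0) isT) (deletable_out uw' (i := 0) isT).
Qed.

(** A common ancestor owns only one deletable link, so both downward paths continue with the same
    vertex. Neither ends early, as a buyer's only deletable link is its crossing. *)
Lemma ancestors_disjoint u w u' w' i j : cross u w -> cross u' w' ->
  i <= 3 -> j <= 3 -> iter i par u = iter j par u' -> u = u'.
Proof.
have aux v y v' y' k : cross v y -> cross v' y' -> k.+1 <= 3 -> v = iter k.+1 par v' -> False.
  move=> vy vy' le_k eq; have dl := deletable_out vy' le_k; rewrite -eq in dl.
  have /= e := deletable_inj (cross_nroot vy).1 (deletable_out vy (i := 0) isT) dl.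
  by case/and3P: vy => _ /eqP[]; rewrite e eq.
move=> uw uw'; elim: i j => [|i IH] [|j] // le_i le_j eq.
- by case: (aux _ _ _ _ _ uw uw' le_j eq).
- by case: (aux _ _ _ _ _ uw' uw le_i (esym eq)).
apply: IH (ltnW le_i) (ltnW le_j) _.
have dl := deletable_out uw' le_j; rewrite -eq in dl.
apply: deletable_inj (deletable_out uw le_i) dl.
by rewrite -dep_gt0 dep_iter; have := cross_deep uw; lia.
Qed.


(** * Two consecutive vertices of degree two *)

(* When z1 has degree two in the core, branch z1 z0 is the tree hanging at z1,
   and thin says that it is left only through z1, towards par z1 or z0. *)
Definition branch z1 z0 x := desc z1 x && ~~ desc z0 x.

Definition thin z1 z0 := forall x y,
  branch z1 z0 x -> ~~ branch z1 z0 y -> adj s x y ->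
  x = z1 /\ (y = par z1 \/ y = z0).

(** A geodesic from [v] to [x] has to leave the branch, and its first vertex outside is [z0] or
    [par z1]. *)
Lemma thin_closer z1 z0 v x : thin z1 z0 -> branch z1 z0 v -> ~~ branch z1 z0 x ->
  d z0 x < d v x \/ d (par z1) x < d v x.
Proof.
move=> th; have [k] := ubnP (d v x); elim: k v => // k IH v le_k bv nbx.
have vx : v != x by apply: contraNneq nbx => <-.
have [y vy dy] := closer_neighbour vx.
have [yb|ynb] := boolP (branch z1 z0 y).
  by have [] : d z0 x < d y x \/ d (par z1) x < d y x; [apply: IH => //|left|right]; lia.
by have [_ [] e] := th v y bv ynb vy; rewrite -e dy; [right|left].
Qed.

Lemma sum_bool (P : pred 'I_n) : \sum_x (P x : nat) = #|P|.
Proof.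
rewrite -sum1_card [RHS]big_mkcond; apply: eq_bigr => x _.
by rewrite unfold_in; case: (P x).
Qed.

Definition lower z1 z0 x := ~~ branch z1 z0 x && (d z1 x < d (par z1) x).

(* par z1 replaces its edge to z1 by an edge to z0: this costs one more for the
   branch at z1 and one less for the vertices counted by lower. *)
Lemma lower_card z1 z0 : z1 != r -> z1 \in s (par z1) -> adj s z1 z0 ->
  z0 != par z1 -> ~~ desc z0 z1 -> thin z1 z0 ->
  #|lower z1 z0| <= #|branch z1 z0|.
Proof.
move=> z1r own a10 z02 nd th; have [a12 dz1] := parP z1r.
have [z2 e2] : exists z2, par z1 = z2 by exists (par z1).
rewrite e2 in own z02 a12 dz1.
have z21 : z1 != z2 by apply: adj_neq.
pose t := z0 |: (s z2 :\ z1).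
have nt : z2 \notin t by rewrite !inE eq_sym (negbTE z02) (negbTE (valid z2)) andbF.
pose f x := if branch z1 z0 x then (d z2 x).+1 else
  if d z1 x < d z2 x then (d z2 x).-1 else d z2 x.
have lef : D z2 <= \sum_x f x.
  apply: replace nt _ _ => [|x].
    by rewrite [X in _ <= X](cardsD1 z1) own cardsU1 leq_add2r; case: (_ \notin _).
  rewrite /f; case: ifPn => [/andP[d1x d0x]|nb].
    have le_z1x := desc_dep d1x; have := gdist_dep z2 x => ge2.
    apply: (@ball_le _ _ _ (dep x - dep z1).+2).
      by move: le_z1x ge2 dz1; clear; lia.
    apply: (ball_cons (v := z0)).
      by rewrite adj_deviate_at // !inE eqxx.
    apply: (ball_cons (v := z1)); first by rewrite adj_deviate // adj_sym.
    by apply: deviate_drop => //; rewrite dz1 leqnn orbT.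
  case: ltnP => [lt|ge].
    have b1 : branch z1 z0 z1 by rewrite /branch descxx.
    (* A geodesic from [z1] to [x] leaves through [z0], because [par z1] is not closer to [x]. *)
    have lt0 : d z0 x < d z1 x.
      by have [//|] := thin_closer th b1 nb; rewrite e2 ltnNge (ltnW lt).
    apply: (@ball_le _ _ _ (d z0 x).+1); first by move: lt lt0; clear; lia.
    apply: (ball_cons (v := z0)); last exact: deviate_closer (ltn_trans lt0 lt).
    by rewrite adj_deviate_at // !inE eqxx.
  by apply: deviate_unaffected ge; apply: subsetUr.
have : \sum_x (f x + lower z1 z0 x) <= \sum_x (d z2 x + branch z1 z0 x).
  apply: leq_sum => x _; rewrite /f /lower e2.
  have [_|_] /= := boolP (branch z1 z0 x); first by rewrite addn0 addn1.
  have [lt|ge] := ltnP (d z1 x) (d z2 x); last by [].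
  by rewrite addn1 addn0 (ltn_predK lt).
rewrite !big_split /= !sum_bool => le_sum; rewrite -(leq_add2l (D z2)).
by apply: leq_trans le_sum; rewrite leq_add2r.
Qed.

(* Adds to the deviation of z1 from z0 to r the inequality D r <= D z3, where z3 is
   the grandparent of z1.  Vertex by vertex the sum gains at least dep z3 on the
   branch at z1, loses at most 9 on lower, and loses nothing elsewhere. *)
Lemma thin_pair z1 z0 : deletable z1 z0 -> z1 \in s (par z1) -> 12 <= dep z1 ->
  z0 != par z1 -> ~~ desc z0 z1 -> thin z1 z0 -> thin (par z1) z1 -> False.
Proof.
move=> del0 own deep z02 nd th1 th2.
have z1r : z1 != r by rewrite -dep_gt0; lia.
have a10 : adj s z1 z0 by rewrite /adj del0.1.
have le_card := lower_card z1r own a10 z02 nd th1.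
have [a12 dz1] := parP z1r; have [z2 e2] : exists z2, par z1 = z2 by exists (par z1).
rewrite e2 in own z02 th2 a12 dz1.
have z2r : z2 != r by rewrite -dep_gt0; lia.
have [a23 dz2] := parP z2r; have [z3 e3] : exists z3, par z2 = z3 by exists (par z2).
rewrite e3 in a23 dz2.
(* In turn: down inside the branch; the general bound of [hub_anywhere]; over the edge to [z2],
   which [z2] owns; over the new link to [r]. *)
pose f x := if branch z1 z0 x then dep x - dep z1 else
  if d z1 x < d z2 x then dep x + 7 else
  if desc z2 x then (dep x - dep z2).+1 else (dep x).+1.
have n1 x : d z2 x <= d z1 x -> ~~ desc z1 x.
  move=> ge; apply/negP => z1x.
  move: (gdist_desc z1x) (gdist_dep z2 x) (desc_dep z1x) ge dz1.
  by clear; lia.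
have lef : D z1 <= \sum_x f x.
  apply: replace (hub_notin _ z1r) _ _ => [|x].
    have := @card_hub z1 [set z0].
    by rewrite sub1set del0.1 cards1 addn1 ltnS => /(_ isT); apply.
  rewrite /f; case: ifPn => [/andP[z1x z0x]|nb].
    by apply: hub_inside => // c; rewrite inE => /eqP->.
  case: ltnP => [_|ge].
    by apply: hub_anywhere => // c; rewrite inE => /eqP->; apply: del0.2.
  case: ifP => z2x; last by apply: hub_outside => //; apply: n1.
  apply: (ball_cons (v := z2)).
    by rewrite adj_deviate_at ?own ?orbT // eq_sym adj_neq.
  by apply: deviate_drop; rewrite // n1.
have : \sum_x (f x + d z3 x + dep z3 * branch z1 z0 x) <=
       \sum_x (d z1 x + dep x + lower z1 z0 x * 9).
  apply: leq_sum => x _; rewrite /f /lower e2.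
  have t32 := gdist_triangle z2 z3 x; have := gdist_adj a23; rewrite gdistC => a32.
  have t21 := gdist_triangle z1 z2 x; have := gdist_adj a12; rewrite gdistC => a21.
  have g1 := gdist_dep z1 x; have g2 := gdist_dep z2 x.
  have up y : desc y x -> y = z1 \/ y = z2 -> d z3 x <= dep x - dep z3 /\ dep z2 <= dep x.
    move=> yx yz; have z2x : desc z2 x.
      by case: yz yx => -> // z1x; apply: desc_trans z1x; rewrite -e2; apply: (desc_iter 1).
    split; last exact: desc_dep.
    by apply: gdist_desc; apply: desc_trans z2x; rewrite -e3; apply: (desc_iter 1).
  case: ifPn => [/andP[z1x z0x]|nb] /=.
    by move: (up z1 z1x (or_introl erefl)) (desc_dep z1x) g1 dz2; clear; lia.
  (* The loss of 9 on [lower] is the 7 of [hub_anywhere] plus the two steps from [z3] to [z1]. *)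
  case: ltnP => [lt|ge] /=; first by move: t32 a32 t21 a21; clear; lia.
  case: ifPn => [z2x|z2x].
    by move: (up z2 z2x (or_intror erefl)) ge g2 dz1 dz2 deep; clear; lia.
  have b2 : branch z2 z1 z2.
    by rewrite /branch descxx; apply/negP => /desc_dep; rewrite dz1 ltnn.
  have nb2 : ~~ branch z2 z1 x by rewrite /branch (negbTE z2x).
  (* Now [z1] is not closer to [x] than [z2], so [z3] is, and this pays for the link to [r]. *)
  by move: (thin_closer th2 b2 nb2) ge; rewrite e3; clear; lia.
rewrite !big_split /= -big_distrr -big_distrl /= !sum_bool => le_sum.
have : dep z3 * #|branch z1 z0| <= #|branch z1 z0| * 9.
  apply: (@leq_trans (#|lower z1 z0| * 9)); last by rewrite leq_mul2r le_card.
  rewrite -(leq_add2l (D z1 + D r)); apply: leq_trans le_sum.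
  by rewrite leq_add2r leq_add.
(* The branch contains [z1], so it may be cancelled; but [dep z3 = dep z1 - 2] is at least 10. *)
rewrite mulnC leq_pmul2l; first by move: deep dz1 dz2; clear; lia.
by apply/card_gt0P; exists z1; rewrite unfold_in /branch descxx.
Qed.

(** * The core of the tree and its degrees *)

Lemma adj_cases x y : adj s x y -> [\/ par x = y, par y = x, cross x y | cross y x].
Proof.
move=> xy; have [e|nx] := eqVneq (par x) y; first by constructor 1.
have [e|ny] := eqVneq (par y) x; first by constructor 2.
by case/orP: xy => h; [constructor 3|constructor 4]; rewrite /cross h ?nx ?ny.
Qed.

Definition crossings := [set e : 'I_n * 'I_n | cross e.1 e.2].

(** The union of the tree paths from [r] to the ends of the crossings. *)
Definition core v := [exists e in crossings, desc v e.1 || desc v e.2].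

Definition kids v := [set c | [&& core c, c != r & par c == v]].

Definition ends v :=
  #|[set e in crossings | e.1 == v]| + #|[set e in crossings | e.2 == v]|.

(** For [v] other than [r] this means degree at most two in the core with its crossings; the parent
    edge is not counted. *)
Definition good v := #|kids v| + ends v <= 1.

Lemma core_up v x : desc v x -> core x -> core v.
Proof.
move=> vx /existsP[e /andP[eX xe]]; apply/existsP; exists e; rewrite eX /=.
by case/orP: xe => xe; rewrite (desc_trans vx xe) ?orbT.
Qed.

Lemma core_cross u w v : cross u w -> desc v u || desc v w -> core v.
Proof. by move=> uw vuw; apply/existsP; exists (u, w); rewrite inE uw. Qed.

Lemma ends_out u w : cross u w -> 0 < #|[set e in crossings | e.1 == u]|.
Proof. by move=> uw; apply/card_gt0P; exists (u, w); rewrite !inE /= uw eqxx. Qed.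

Lemma ends_in u w : cross u w -> 0 < #|[set e in crossings | e.2 == w]|.
Proof. by move=> uw; apply/card_gt0P; exists (u, w); rewrite !inE /= uw eqxx. Qed.

Lemma ends_gt0 u w : cross u w -> 0 < ends u /\ 0 < ends w.
Proof. by move=> uw; rewrite !addn_gt0 (ends_out uw) (ends_in uw) orbT. Qed.

Lemma good_kid z c : good z -> c \in kids z -> ends z = 0.
Proof.
move=> gd ck; apply/eqP; rewrite -leqn0 leqNgt; apply/negP => e0; move: gd.
rewrite /good leqNgt => /negP; apply; rewrite -[2]/(1 + 1); apply: leq_add => //.
by apply/card_gt0P; exists c.
Qed.

Lemma good_in_out z y y' : good z -> cross z y -> cross y' z -> False.
Proof.
move=> /(leq_trans (leq_addl _ _)); rewrite leqNgt => /negP le1 zy y'z; apply: le1.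
by rewrite -[2]/(1 + 1) leq_add ?(ends_out zy) ?(ends_in y'z).
Qed.

Lemma kids_gt0 z x : core x -> desc z x -> z != x ->
  exists2 c, c \in kids z & desc c x.
Proof.
move=> xC zx nzx; have [c [cz cr cx _]] := desc_child zx nzx.
by exists c => //; rewrite inE cr cz eqxx (core_up cx).
Qed.

Lemma core_degree v : core v -> 0 < #|kids v| + ends v.
Proof.
case/existsP=> [[u w]] /andP[]; rewrite inE /= => uw vuw.
have uC x : (x == u) || (x == w) -> core x.
  by case/orP=> /eqP->; apply: (core_cross uw); rewrite descxx ?orbT.
have [e|nvu] := eqVneq v u; first by rewrite e /ends; have := ends_out uw; lia.
have [e|nvw] := eqVneq v w; first by rewrite e /ends; have := ends_in uw; lia.
rewrite addn_gt0; apply/orP; left.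
apply/card_gt0P; case/orP: vuw => vx.
  by have [|c ck _] := kids_gt0 (uC u _) vx nvu; [rewrite eqxx|exists c].
by have [|c ck _] := kids_gt0 (uC w _) vx nvw; [rewrite eqxx orbT|exists c].
Qed.

Definition bad := [set v | [&& core v, v != r & ~~ good v]].

(** Double counting: [#|kids v| + ends v] sums to the number of core vertices other than [r] plus
    twice the number of crossings. Each core vertex, [r] included, contributes at least one, and
    each bad vertex at least two. *)
Lemma bad_card u w : cross u w -> #|bad| < 2 * #|crossings|.
Proof.
move=> uw; pose K := [set c | core c && (c != r)].
have kidsE : \sum_v #|kids v| = #|K|.
  rewrite -[RHS]sum1dep_card [RHS](partition_big par predT) //=; apply: eq_bigr => v _.
  by rewrite -sum1dep_card; apply: eq_bigl => c; rewrite andbA.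
have endsE : \sum_v ends v = 2 * #|crossings|.
  rewrite big_split /= mul2n -addnn; congr (_ + _).
    rewrite -[RHS]sum1_card [RHS](partition_big fst predT) //=; apply: eq_bigr => v _.
    by rewrite sum1dep_card.
  rewrite -[RHS]sum1_card [RHS](partition_big snd predT) //=; apply: eq_bigr => v _.
  by rewrite sum1dep_card.
have rC : core r by apply: (core_cross uw); rewrite desc_root.
have : \sum_v ((v \in K) + (v \in bad) + (v == r)) <= \sum_v (#|kids v| + ends v).
  apply: leq_sum => v _; rewrite !inE; have [->|vr] /= := eqVneq v r.
    by rewrite andbF; apply: core_degree.
  have [vC|] /= := boolP (core v); last by [].
  have := core_degree vC; rewrite /good; case: leqP => /=; lia.
rewrite [leqRHS]big_split /= kidsE endsE !big_split /= !sum_bool -addnA leq_add2l.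
suff -> : #|(fun v => v == r)| = 1 by rewrite addn1.
exact: (card1 r).
Qed.

(** As [z1] is good, [z0] is its only core child or the other end of its only crossing. So no
    crossing ends in the branch except possibly at [z1], and all other edges are tree edges. *)
Lemma thin_good z1 z0 : z1 != r -> good z1 -> z0 \in kids z1 \/ cross z1 z0 ->
  thin z1 z0.
Proof.
move=> z1r gd link x y /andP[z1x nz0x] nby xy.
have desc0 : desc z1 y -> desc z0 y.
  by move=> z1y; apply: contraNT nby => nz0y; rewrite /branch z1y.
have endx : cross x y \/ cross y x -> 0 < ends x /\ core x.
  case=> c; have [e1 e2] := ends_gt0 c.
    by split=> //; apply: (core_cross c); rewrite descxx.
  by split=> //; apply: (core_cross c); rewrite descxx orbT.
have [e|ne] := eqVneq x z1; last first.
  have nz1x : z1 != x by rewrite eq_sym.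
  suff [e1|e2] : par x = y \/ par y = x.
  - have /desc0 z0y : desc z1 y by rewrite -e1 desc_up.
    by case/negP: nz0x; apply: desc_par; rewrite e1.
  - have /desc0 z0y : desc z1 y by apply: desc_par; rewrite e2.
    have [ey|nz0y] := eqVneq z0 y; last by case/negP: nz0x; rewrite -e2 desc_up.
    case: link => [|cr]; last first.
      have := cross_exit (j := 0) cr isT; case/negP => /=.
      by apply: desc_par; rewrite ey e2.
    by rewrite inE ey e2 (negbTE ne) !andbF.
  (* A crossing at [x] would put [x] below a core child of [z1], which could only be [z0]. *)
  have nocr : cross x y \/ cross y x -> False.
    move=> /endx[_ xC]; have [c ck cx] := kids_gt0 xC z1x nz1x.
    case: link => [z0k|/ends_gt0[]]; last by rewrite (good_kid gd ck).
    have /card_le1_eqP inj : #|kids z1| <= 1 by apply: leq_trans gd; apply: leq_addr.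
    have e0 : z0 = c by apply: inj.
    by case/negP: nz0x; rewrite e0.
  by case: (adj_cases xy) => h; [left|right|case: nocr; left|case: nocr; right].
split=> //; rewrite e in endx xy nz0x.
case: (adj_cases xy) => h; first by left.
- right; have [ey|nz0y] := eqVneq z0 y; first by [].
  case/negP: nz0x; rewrite -h; apply: desc_up nz0y; apply: desc0.
  by apply: desc_par; rewrite h descxx.
- case: link => [z0k|cr]; last by right; apply: cross_inj h cr.
  by have [|] := endx; [left|rewrite (good_kid gd z0k)].
case: link => [z0k|cr]; last by case: (good_in_out gd cr h).
by have [|] := endx; [right|rewrite (good_kid gd z0k)].
Qed.

(** * Two bad vertices above each buyer *)

Lemma kids_iter u w i : cross u w -> i <= 3 ->
  iter i par u != r /\ iter i par u \in kids (iter i.+1 par u).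
Proof.
move=> uw le_i; have ir : iter i par u != r.
  by rewrite -dep_gt0 dep_iter; have := cross_deep uw; lia.
by rewrite inE ir eqxx (core_cross uw) ?desc_iter.
Qed.

Lemma bad_iter u w i : cross u w -> i <= 3 -> ~~ good (iter i par u) -> iter i par u \in bad.
Proof.
by move=> uw /(kids_iter uw)[ir]; rewrite !inE ir eqxx => /andP[-> _].
Qed.

(** Otherwise [thin_pair] applies with [z1 = u] and [z0 = w]. *)
Lemma bad_low u w : cross u w -> ~~ (good u && good (par u)).
Proof.
move=> uw; apply/negP => /andP[g0 g1].
have deep := cross_deep uw; have [ur _] := cross_nroot uw.
have [_ uk] := kids_iter (i := 0) uw isT; have [pr _] := kids_iter (i := 1) uw isT.
have dl := deletable_out (i := 0) uw isT; have [own _] := deletable_out (i := 1) uw isT.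
have npw : w != par u by case/and3P: uw => _ _; rewrite eq_sym.
apply: (thin_pair dl own) => //; first by apply: leq_trans deep.
(* A proper ancestor adjacent to [u] is at most one level higher, so it would be [par u]. *)
- apply/negP => wu; have nwu : w != u.
    by rewrite eq_sym; apply: adj_neq; apply: cross_adj.
  have wp := desc_up wu nwu; have := dep_par u; have := desc_dep wp.
  have := dep_adj (_ : adj s w u); rewrite adj_sym => /(_ (cross_adj uw)) a b c.
  have e0 : dep (par u) - dep w = 0 by move: a b c; clear; lia.
  by move: wp; rewrite /desc e0 /= eq_sym (negbTE npw).
- by apply: thin_good => //; right.
by apply: thin_good => //; left.
Qed.

(** Otherwise [thin_pair] applies with [z1 = iter 2 par u] and [z0 = par u]; by [cross_deep] the
    depth of [z1] is at least 16. *)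
Lemma bad_high u w : cross u w -> ~~ (good (iter 2 par u) && good (iter 3 par u)).
Proof.
move=> uw; apply/negP => /andP[g2 g3]; have deep := cross_deep uw.
have [r1 k1] := kids_iter (i := 1) uw isT; have [r2 k2] := kids_iter (i := 2) uw isT.
have [r3 _] := kids_iter (i := 3) uw isT.
have dl := deletable_out (i := 2) uw isT; have [own _] := deletable_out (i := 3) uw isT.
apply: (thin_pair dl own); rewrite /out.
- by rewrite dep_iter; move: deep; clear; lia.
- apply/eqP => /(congr1 dep); rewrite -[par _]/(iter 3 par u) !dep_iter.
  by move: deep; clear; lia.
- by apply/negP => /desc_dep; rewrite !dep_iter; move: deep; clear; lia.
- by apply: thin_good => //; left.
by apply: thin_good => //; left.
Qed.

(** Each crossing yields one bad vertex among [u], [par u] and one among the next two ancestors. By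
    [ancestors_disjoint] and [cross_inj] all of these are distinct, which contradicts [bad_card]. *)
Lemma no_cross u w : ~~ cross u w.
Proof.
apply/negP => uw; have := bad_card uw; apply/negP; rewrite -leqNgt mul2n -addnn.
pose i1 v := if good v then 1 else 0.
pose i2 v := if good (iter 2 par v) then 3 else 2.
pose g1 (e : 'I_n * 'I_n) := iter (i1 e.1) par e.1.
pose g2 (e : 'I_n * 'I_n) := iter (i2 e.1) par e.1.
have le1 v : i1 v <= 1 by rewrite /i1; case: ifP.
have ge2 v : 1 < i2 v by rewrite /i2; case: ifP.
have i1_le v : i1 v <= 3 by apply: leq_trans (le1 v) _.
have i2_le v : i2 v <= 3 by rewrite /i2; case: ifP.
have inj (e e' : 'I_n * 'I_n) i j : e \in crossings -> e' \in crossings ->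
    i <= 3 -> j <= 3 -> iter i par e.1 = iter j par e'.1 -> e = e' /\ i = j.
  case: e e' => [v y] [v' y']; rewrite !inE /= => vy v'y' le_i le_j eq.
  have e := ancestors_disjoint vy v'y' le_i le_j eq; rewrite -e in v'y' eq *.
  split; first by rewrite (cross_inj vy v'y').
  by move/(congr1 dep): eq; rewrite !dep_iter; have := cross_deep vy; lia.
have c1 : #|g1 @: crossings| = #|crossings|.
  apply: card_in_imset => e e' eX e'X eq.
  by have [] := inj _ _ _ _ eX e'X (i1_le _) (i1_le _) eq.
have c2 : #|g2 @: crossings| = #|crossings|.
  apply: card_in_imset => e e' eX e'X eq.
  by have [] := inj _ _ _ _ eX e'X (i2_le _) (i2_le _) eq.
rewrite -{1}c1 -c2 -cardsUI.
have -> : g1 @: crossings :&: g2 @: crossings = set0.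
  apply/setP => v; rewrite !inE; apply/negP => /andP[/imsetP[e eX ->] /imsetP[e' e'X eq]].
  have [_ e12] := inj _ _ _ _ eX e'X (i1_le _) (i2_le _) eq.
  by have := ge2 e'.1; rewrite -e12 ltnNge le1.
rewrite cards0 addn0; apply: subset_leq_card; rewrite subUset; apply/andP; split.
  apply/subsetP => _ /imsetP[[v y] vy ->]; rewrite inE /= in vy.
  rewrite /g1 /=; apply: (bad_iter vy) => //.
  by have := bad_low vy; rewrite /i1 negb_and; case: ifP => //= ->.
apply/subsetP => _ /imsetP[[v y] vy ->]; rewrite inE /= in vy.
rewrite /g2 /=; apply: (bad_iter vy) => //.
by have := bad_high vy; rewrite /i2 negb_and; case: ifP => //= ->.
Qed.

(** * From the absence of crossings to acyclicity *)

(** All edges are tree edges, so at a deepest vertex of a cycle both cycle neighbours would be its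
    parent; in a cycle of length at least three they are distinct. *)
Lemma no_cycle p : ~ (ucycle (adj s) p /\ 3 <= size p).
Proof.
case=> cyc sz; have [x0 x0p] : exists x0, x0 \in p.
  by case: p sz {cyc} => // a q _; exists a; apply: mem_head.
case: (arg_maxnP dep (x0p : (fun x => x \in p) x0)) => x xp xmax.
have [i q ip] := rot_to xp.
move: cyc sz; rewrite -(rot_ucycle i) -(size_rot i) ip.
have pq y : y \in q -> y \in p by move=> yq; rewrite -(mem_rot i) ip inE yq orbT.
case: q pq {ip} => [|y q] // pq /andP[/= /andP[xy]].
rewrite rcons_path => /andP[_ lx] /and3P[_ yq _] sz.
have up z : z \in p -> adj s x z -> par x = z.
  move=> zp xz; case: (adj_cases xz) => // [e|c|c]; last 2 first.
  - by have := no_cross x z; rewrite c.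
  - by have := no_cross z x; rewrite c.
  have [zr|/parP[_]] := eqVneq z r.
    by have := adj_neq xz; rewrite -e zr par_root eqxx.
  by rewrite e; have := xmax z zp; lia.
have ey := up y (pq y (mem_head _ _)) xy.
have el := up (last y q) (pq _ (mem_last _ _)); rewrite adj_sym in el.
move: yq; rewrite -ey (el lx); case: q sz {pq lx el} => //= a q _.
by rewrite mem_last.
Qed.

End Structure.

Local Open Scope ring_scope.

Theorem theorem2 (R : realFieldType) (n : nat) (alpha : R)
  (halpha0 : 0 < alpha) (halpha : 17 * n%:R < alpha) (s : strategy n) :
  nash_equilibrium alpha s -> is_tree s.
Proof.
move=> nash; have [valid _] := nash; have conn := nash_connected nash.
split=> [u v|[|a p]]; [by rewrite -connect_ball|by case|].
(* The first vertex [a] of the supposed cycle shows that there are players to minimize over. *)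
have [r _ r_min] := arg_minnP (fun u => \sum_x gdist s u x)%N (isT : predT a).
apply: (no_cycle valid conn (r := r)).
- by move=> u t f; apply: (nash_replace halpha0 nash).
- by move=> u t f; apply: (nash_delete halpha halpha0 nash).
by move=> u; apply: r_min.
Qed.
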